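(* Let $X$ be a continuum with metric $d$ and let $F\colon X\to 2^X$ be an upper semicontinuous function. Consider the statements: (1) $F$ is strongly sensitive; (2) $F$ is sensitive; (3) $F$ is weakly sensitive. Then (1) implies (2), and (2) implies (3).
   Context: A continuum is a connected compact metric space. $2^X$ denotes the family of all nonempty closed subsets of $X$, and $\mathcal{H}$ denotes the Hausdorff metric on $2^X$ induced by $d$; $\mathbb N=\{1,2,3,\ldots\}$. A function $F\colon X\to 2^X$ is upper semicontinuous if for each $x\in X$ and every open $V\subseteq X$ with $F(x)\subseteq V$, there is an open $U\subseteq X$ with $x\in U$ and $F(y)\subseteq V$ for all $y\in U$. For $A\subseteq X$, $F(A)=\bigcup\{F(x):x\in A\}$; $F^1=F$ and $F^{n+1}(x)=F(F^n(x))$ for $x\in X$, $n\in\mathbb N$ (if $F$ is upper semicontinuous, then each $F^n(x)\in 2^X$). The orbit set of $x\in X$ is $\mathcal{O}_F(x)=\{(x_n)_{n\in\mathbb N}\in X^{\mathbb N} : x_1=x \text{ and } x_{n+1}\in F(x_n) \text{ for each } n\in\mathbb N\}$, and $\pi_m\colon X^{\mathbb N}\to X$ is the projection onto the $m$-th coordinate. For $A\subseteq X$ and $r>0$, $\mathcal{V}_r(A)=\{x\in X : d(x,a)<r \text{ for some } a\in A\}$, and $\mathcal{V}_r(a)=\mathcal{V}_r(\{a\})$. $F$ is strongly sensitive if there exists $\varepsilon>0$ such that for each $x\in X$ and $\delta>0$ there exist $y\in\mathcal{V}_\delta(x)$ and $m\in\mathbb N$ such that $F^m(y)\nsubseteq\mathcal{V}_\varepsilon(F^m(x))$.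 $F$ is sensitive if there exists $\varepsilon>0$ such that for each $x\in X$ and $\delta>0$ there exist $y\in\mathcal{V}_\delta(x)$ and $m\in\mathbb N$ such that $\mathcal{H}(F^m(x),F^m(y))\geq\varepsilon$. $F$ is weakly sensitive if there exists $\varepsilon>0$ such that for each $x\in X$ and $\delta>0$ there exist $y\in\mathcal{V}_\delta(x)$, $\overline{x}\in\mathcal{O}_F(x)$, $\overline{y}\in\mathcal{O}_F(y)$ and $m\in\mathbb N$ such that $d(\pi_m(\overline{x}),\pi_m(\overline{y}))\geq\varepsilon$. *)

(* Defs.v *)
From HB Require Import structures.
From mathcomp Require Import all_boot all_order all_algebra.
From mathcomp Require Import all_classical all_reals all_analysis.
Set Implicit Arguments.
Unset Strict Implicit.
Unset Printing Implicit Defensive.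
Import Order.TTheory GRing.Theory Num.Theory.
Local Open Scope classical_set_scope.
Local Open Scope ring_scope.

(* Positive integers are the naturals n with (0 < n)%N; definitions indexed by
   them use n.-1, so their value at n = 0 is junk. *)

Definition continuum (R : realType) (X : metricType R) : Prop :=
  compact [set: X] /\ connected [set: X].

(* 2^X, as a family of sets *)
Definition hyperspace (R : realType) (X : metricType R) : set (set X) :=
  [set A | closed A /\ A !=set0].

Definition set_nbhd (R : realType) (X : metricType R) (r : R) (A : set X)
  : set X := [set x | exists2 a, A a & mdist x a < r].

Definition hausdorff_dist (R : realType) (X : metricType R) (A B : set X) : R :=
  inf [set r : R | [/\ 0 < r, A `<=` set_nbhd r B & B `<=` set_nbhd r A]].

Section SetValued.
Context (R : realType) (X : metricType R).
Implicit Types (F : X -> set X) (A : set X) (x : X) (n m : nat).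

Definition upper_semicontinuous F : Prop :=
  forall x (V : set X), open V -> F x `<=` V ->
    exists U : set X, [/\ open U, U x & forall y, U y -> F y `<=` V].

Definition sv_image F A : set X := \bigcup_(x in A) F x.

(* F^n for n >= 1: F^1 = F and F^(n+1) x = F (F^n x) *)
Definition sv_iter F n x : set X := iter n.-1 (sv_image F) (F x).

(* pi_m for m >= 1: a sequence x_1, x_2, ... is stored from index 0 *)
Definition seq_proj m (u : nat -> X) : X := u m.-1.

Definition orbit_set F x : set (nat -> X) :=
  [set u | seq_proj 1 u = x /\
           forall n, (0 < n)%N -> F (seq_proj n u) (seq_proj n.+1 u)].

Definition strongly_sensitive F : Prop :=
  exists2 eps : R, 0 < eps & forall x (delta : R), 0 < delta ->
    exists y m, [/\ set_nbhd delta [set x] y, (0 < m)%N &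
      ~ (sv_iter F m y `<=` set_nbhd eps (sv_iter F m x))].

Definition sensitive F : Prop :=
  exists2 eps : R, 0 < eps & forall x (delta : R), 0 < delta ->
    exists y m, [/\ set_nbhd delta [set x] y, (0 < m)%N &
      eps <= hausdorff_dist (sv_iter F m x) (sv_iter F m y)].

Definition weakly_sensitive F : Prop :=
  exists2 eps : R, 0 < eps & forall x (delta : R), 0 < delta ->
    exists y (u v : nat -> X) m,
      [/\ set_nbhd delta [set x] y, orbit_set F x u, orbit_set F y v,
          (0 < m)%N & eps <= mdist (seq_proj m u) (seq_proj m v)].

End SetValued.

(* Main.v *)
Require Import Defs.
From HB Require Import structures.
From mathcomp Require Import all_boot all_order all_algebra.
From mathcomp Require Import all_classical all_reals all_analysis.

(** Compactness makes the Hausdorff distance of nonempty sets the infimum of a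
    nonempty set of radii, so H(A, B) < e gives a radius below e and hence
    B within the e-neighbourhood of A. Conversely, if H(F^m x, F^m y) >= e, then
    e/2 is not an admissible radius, so some point of one of the two sets is at
    distance at least e/2 from every point of the other; points of F^m x and
    F^m y lie on orbits of x and y at position m+1. *)

Set Implicit Arguments.
Unset Strict Implicit.
Unset Printing Implicit Defensive.
Import Order.TTheory GRing.Theory Num.Theory.
Local Open Scope classical_set_scope.
Local Open Scope ring_scope.

Section HausdorffDist.
Context (R : realType) (X : metricType R).
Implicit Types (A B : set X) (r e : R).

(** On the unit ball around [x], every [M] above [mdist x0 x + 1] is a bound; the near-covering form
    of compactness, with the filter of neighbourhoods of infinity, makes the threshold uniform. *)
Lemma compact_mdist_bounded (x0 : X) : compact [set: X] ->
  exists M : R, forall x, mdist x0 x < M.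
Proof.
move=> /compact_near_coveringP cptX.
have [|M [_ bndM]] := cptX R (pinfty_nbhs R) (fun M x => mdist x0 x < M) _.
  move=> x _; exists (ball x 1, [set M | mdist x0 x + 1 < M]) => /=.
    split; first exact: nbhsx_ballx.
    by apply: nbhs_pinfty_gt; rewrite num_real.
  move=> [x' M] /= []; rewrite ballEmdist /= => xx' lt_M.
  by rewrite (le_lt_trans (metric_triangle x0 x x'))// (lt_trans _ lt_M)// ltrD2l.
by exists (M + 1) => x; apply: bndM => //; rewrite ltrDl.
Qed.

Lemma compact_mdist2_bounded : compact [set: X] ->
  exists2 M : R, 0 < M & forall x y : X, mdist x y < M.
Proof.
move=> cptX; have [[x0 _]|X0] := pselect ([set: X] !=set0); last first.
  by exists 1 => // x; case: X0; exists x.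
have [M bndM] := compact_mdist_bounded x0 cptX.
have M0 : 0 < M by rewrite -(mdistxx x0).
exists (M + M) => [|x y]; first exact: addr_gt0.
by rewrite (le_lt_trans (metric_triangle x x0 y))// metric_sym ltrD.
Qed.

Lemma set_nbhd_mono r e A : r <= e -> set_nbhd r A `<=` set_nbhd e A.
Proof. by move=> re x [a Aa xa]; exists a => //; exact: lt_le_trans re. Qed.

Lemma not_sub_set_nbhd e A B : ~ A `<=` set_nbhd e B ->
  exists2 a, A a & forall b, B b -> e <= mdist a b.
Proof.
move=> /existsNP[a /not_implyP[Aa nBa]]; exists a => // b Bb.
by rewrite leNgt; apply/negP => ab; apply: nBa; exists b.
Qed.

(** A bound on all distances is an admissible radius. This matters because [inf] of the empty set
    defaults to 0, which would give no radius below [e]. *)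
Lemma hausdorff_dist_lt e A B : compact [set: X] -> A !=set0 -> B !=set0 ->
  hausdorff_dist A B < e -> B `<=` set_nbhd e A.
Proof.
move=> /compact_mdist2_bounded[M M0 bndM] [a Aa] [b Bb] /inf_lt[|r [_ _ BA]].
  by exists M; split=> // x _; [exists b|exists a].
by move=> /ltW re; exact: subset_trans (set_nbhd_mono re).
Qed.

Lemma hausdorff_dist_le r A B : 0 < r ->
  A `<=` set_nbhd r B -> B `<=` set_nbhd r A -> hausdorff_dist A B <= r.
Proof.
by move=> r0 AB BA; apply: ge_inf => //; exists 0 => s [/ltW].
Qed.

(** Since [r] is not admissible, one set has a point at distance at least [r] from all of the other;
    nonemptiness supplies its partner. *)
Lemma hausdorff_dist_gt r A B : 0 < r -> A !=set0 -> B !=set0 ->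
  r < hausdorff_dist A B -> exists a b, [/\ A a, B b & r <= mdist a b].
Proof.
move=> r0 [a0 Aa0] [b0 Bb0] ltr.
have [AB|/not_sub_set_nbhd[a Aa far]] := pselect (A `<=` set_nbhd r B); last first.
  by exists a, b0; split => //; exact: far.
have [BA|/not_sub_set_nbhd[b Bb far]] := pselect (B `<=` set_nbhd r A); last first.
  by exists a0, b; rewrite metric_sym; split => //; exact: far.
by move: ltr; rewrite ltNge hausdorff_dist_le.
Qed.

End HausdorffDist.

Section Orbits.
Context (R : realType) (X : metricType R) (F : X -> set X).
Hypothesis F0 : forall x, F x !=set0.

Lemma sv_iter_neq0 n x : sv_iter F n x !=set0.
Proof.
rewrite /sv_iter; elim: n.-1 => [|k [y Fy]]; first exact: F0.
by have [z Fz] := F0 y; exists z; exists y.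
Qed.

(** Induction with [A] general: the innermost [F] is absorbed into the starting set, and a preimage
    in [A] is prepended. *)
Lemma iter_sv_image_trajectory n (A : set X) a : iter n (sv_image F) A a ->
  exists u : nat -> X, [/\ A (u 0%N), forall k, F (u k) (u k.+1) & u n = a].
Proof.
elim: n A => [|n IHn] A.
  (* The trajectory must be infinite, so beyond [a] it follows a selection of [F]. *)
  move=> Aa; have [f Ff] := choice F0.
  by exists (fun k => iter k f a); split=> // k; exact: Ff.
rewrite iterSr => /IHn[u [[x Ax Fxu] Fu una]].
by exists (fun k => if k is k'.+1 then u k' else x); split=> // -[].
Qed.

Lemma sv_iter_orbit n x a : (0 < n)%N -> sv_iter F n x a ->
  exists2 u, orbit_set F x u & seq_proj n.+1 u = a.
Proof.
case: n => // n _ /iter_sv_image_trajectory[u [Fxu Fu una]].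
exists (fun k => if k is k'.+1 then u k' else x) => //.
by split=> [|[|[|k]]] // _; exact: Fu.
Qed.

End Orbits.

Theorem proposition6p1 (R : realType) (X : metricType R) (F : X -> set X)
    (hX : continuum X)
    (hF : forall x : X, hyperspace (F x))
    (husc : upper_semicontinuous F) :
  (strongly_sensitive F -> sensitive F) /\ (sensitive F -> weakly_sensitive F).
Proof.
have [cptX _] := hX.
have F0 x : F x !=set0 by case: (hF x).
split=> -[e e0 sens].
  exists e => // x d d0; have [y [m [xy m0 far]]] := sens x d d0.
  exists y, m; split=> //; rewrite leNgt; apply/negP => close.
  by apply: far; apply: hausdorff_dist_lt close => //; exact: sv_iter_neq0.
(* Halving turns the bound [e <=] into the strict one that [hausdorff_dist_gt] requires. *)
exists (e / 2) => [|x d d0]; first exact: divr_gt0.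
have [y [m [xy m0 far]]] := sens x d d0.
have [||||a [b [Fa Fb ab]]] := @hausdorff_dist_gt _ _ (e / 2) (sv_iter F m x) (sv_iter F m y).
- exact: divr_gt0.
- exact: sv_iter_neq0.
- exact: sv_iter_neq0.
- by rewrite (lt_le_trans _ far)// ltr_pdivrMr// ltr_pMr// ltr1n.
have [u xu ua] := sv_iter_orbit F0 m0 Fa.
have [v yv vb] := sv_iter_orbit F0 m0 Fb.
by exists y, u, v, m.+1; split; rewrite // ua vb.
Qed.
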